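(* Let $\mathcal{V}=(\mathcal{T},\alpha,\nu)$ be a (transverse taut) veering triangulation of $M$. Then the lower taut module $\mathcal{E}^L_\alpha(\mathcal{V})$ is isomorphic to the upper taut module $\mathcal{E}^U_\alpha(\mathcal{V})$ (as $\mathbb{Z}[H]$-modules). Hence the lower and upper taut polynomials satisfy $$\Theta^L_{\mathcal{V}}=\Theta^U_{\mathcal{V}}$$ up to a unit in $\mathbb{Z}[H]$.
   Context: Throughout, $M$ is a compact, oriented, connected 3-manifold with a finite positive number of toroidal boundary components (equivalently, replacing boundary components by cusps, a cusped manifold), with an ideal triangulation $\mathcal{T}=(T,F,E)$: $T,F,E$ are the sets of ideal tetrahedra, triangles and edges, with $|T|=|E|=n$, $|F|=2n$. Edges/triangles of a higher-dimensional simplex are counted as embeddings. Transverse taut: a coorientation $\alpha$ is given on every triangle such that for each tetrahedron $t$ two faces (the top faces) are cooriented out of $t$ and two (the bottom faces) into $t$; $t$ is immediately below its top faces and immediately above its bottom faces. The top (bottom) diagonal of $t$ is the common edge of its two top (bottom) faces; the other four edges are equatorial. Assign angle $\pi$ to the two diagonals and $0$ to the equatorial edges; it is required that for each $e\in E$ the angles over all embeddings of $e$ into tetrahedra sum to $2\pi$. So each $e$ is the top diagonal of exactly one tetrahedron (the one immediately below $e$) and the bottom diagonal of exactly one (the one immediately above $e$). Veering: a transverse taut triangulation with a colouring $\nu$ of the edges red/blue such that in each tetrahedron, viewed from above (coorientation towards the viewer, using the orientation of $M$) and drawn as a quadrilateral with vertical top diagonal and horizontal bottom diagonal, the equatorial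 edges of positive slope are red and those of negative slope are blue. Let $H=H_1(M;\mathbb{Z})/\text{torsion}$, $M^{ab}\to M$ the maximal free abelian cover (deck group $H$, written multiplicatively), and $\mathcal{V}^{ab}$ the lifted veering triangulation. Fix a connected fundamental domain whose closure is triangulated by one lift $1\cdot t$ of each $t\in T$; other tetrahedra are $h\cdot t$, $h\in H$. Triangles and edges of $\mathcal{V}^{ab}$ inherit their $H$-coefficient from the unique tetrahedron immediately below them: $h\cdot f$ is a top triangle, and $h\cdot e$ is the top diagonal, of a tetrahedron with $H$-coefficient $h$. Free abelian groups on simplices of $\mathcal{V}^{ab}$ are identified with $\mathbb{Z}[H]^T,\mathbb{Z}[H]^F,\mathbb{Z}[H]^E$. For a triangle $f$ with edges $x_0,x_1,x_2$ of $\mathcal{V}^{ab}$, the lower large edge is the one which is the top diagonal of the tetrahedron immediately below $f$; the upper large edge is the one which is the bottom diagonal of the tetrahedron immediately above $f$. Define $\mathbb{Z}[H]$-homomorphisms $D^L,D^U:\mathbb{Z}[H]^F\to\mathbb{Z}[H]^E$ by $D^{L}(1\cdot f)=x_0-x_1-x_2$ where $x_0$ is the lower large edge of $1\cdot f$ and $x_1,x_2$ are its other two edges, and $D^U(1\cdot f)$ by the same formula with $x_0$ the upper large edge. The lower (upper) taut module $\mathcal{E}^L_\alpha(\mathcal{V})$ ($\mathcal{E}^U_\alpha(\mathcal{V})$) is the cokernel of $D^L$ ($D^U$). The lower (upper) taut polynomial $\Theta^L_{\mathcal{V}}$ ($\Theta^U_{\mathcal{V}}$) is the greatest common divisor of the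 $n\times n$ minors of $D^L$ ($D^U$), i.e. of the zeroth Fitting ideal; it is defined up to a unit of $\mathbb{Z}[H]$, and is $0$ if all minors vanish. *)

(* Defs.v *)
From HB Require Import structures.
From mathcomp Require Import all_boot all_order fingroup perm all_algebra.
From mathcomp Require Import finmap zify.
From mathcomp.multinomials Require Import monalg.
From mathcomp Require Import boolp classical_sets.

Set Implicit Arguments.
Unset Strict Implicit.
Unset Printing Implicit Defensive.

Import GRing.Theory.

(* The axioms of mathcomp.classical serve to decide membership in subgroups
   given by existential formulas. *)

Local Open Scope ring_scope.

(* [{malg int[A]}] is the free abelian group on A, but its library product
   is only available for monoids without nontrivial units; here it gets the
   convolution product of an abelian group A written additively. *)
Definition groupring (A : zmodType) : Type := {malg int[A]}.

HB.instance Definition _ (A : zmodType) :=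
  GRing.Zmodule.copy (groupring A) {malg int[A]}.

(* The group element a as an element of Z[A]. *)
Definition gr (A : zmodType) (a : A) : groupring A := << a >>.

Section GroupRing.
Variable A : zmodType.
Implicit Types g : groupring A.
Local Open Scope fset_scope.

Definition gr_mul g1 g2 : groupring A :=
  \sum_(a <- msupp g1) \sum_(b <- msupp g2) << g1@_a * g2@_b *g (a + b)%R >>.

Lemma gr_mulw (d1 d2 : {fset A}) g1 g2 :
  msupp g1 `<=` d1 -> msupp g2 `<=` d2 ->
  gr_mul g1 g2 = \sum_(a <- d1) \sum_(b <- d2) << g1@_a * g2@_b *g (a + b)%R >>.
Proof.
move=> le1 le2; rewrite /gr_mul (big_fset_incl _ le1) /=.
  apply/eq_bigr=> a _; apply/big_fset_incl => // k _ /mcoeff_outdom ->.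
  by rewrite mulr0 monalgU0.
move=> k _ /mcoeff_outdom g1k.
by rewrite big1 => // k' _; rewrite g1k mul0r monalgU0.
Qed.

Lemma gr_mulC : commutative gr_mul.
Proof.
move=> g1 g2; rewrite /gr_mul exchange_big /=.
by apply/eq_bigr=> a _; apply/eq_bigr=> b _; rewrite mulrC addrC.
Qed.

Lemma gr_mulUU c1 c2 (a b : A) :
  gr_mul << c1 *g a >> << c2 *g b >> = << c1 * c2 *g (a + b)%R >>.
Proof. by rewrite (gr_mulw msuppU_le msuppU_le) !big_seq_fset1 !mcoeffUU. Qed.

Lemma gr_mulUg c (a : A) g :
  gr_mul << c *g a >> g = \sum_(b <- msupp g) << c * g@_b *g (a + b)%R >>.
Proof.
rewrite (gr_mulw msuppU_le (fsubset_refl _)) big_seq_fset1.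
by apply/eq_bigr => b _; rewrite mcoeffUU.
Qed.

Lemma gr_mulDl : left_distributive gr_mul +%R.
Proof.
move=> g1 g2 g.
rewrite [in RHS](gr_mulw (fsubsetUl _ (msupp g2)) (fsubset_refl _)).
rewrite [in RHS](gr_mulw (fsubsetUr (msupp g1) _) (fsubset_refl _)).
rewrite (gr_mulw (msuppD_le _ _) (fsubset_refl _)).
rewrite -big_split /=; apply/eq_bigr=> a _.
rewrite -big_split /=; apply/eq_bigr=> b _.
by rewrite mcoeffD mulrDl monalgUD.
Qed.

Lemma gr_mul0l : left_zero 0 gr_mul.
Proof. by move=> g; rewrite /gr_mul msupp0 big_seq_fset0. Qed.

Lemma gr_mul_suml (I : Type) (r : seq I) (G : I -> groupring A) g :
  gr_mul (\sum_(i <- r) G i) g = \sum_(i <- r) gr_mul (G i) g.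
Proof. exact: (big_morph (gr_mul^~ g) (fun _ _ => gr_mulDl _ _ _) (gr_mul0l _)). Qed.

Lemma gr_mul_sumr (I : Type) (r : seq I) (G : I -> groupring A) g :
  gr_mul g (\sum_(i <- r) G i) = \sum_(i <- r) gr_mul g (G i).
Proof. by rewrite gr_mulC gr_mul_suml; apply/eq_bigr=> i _; rewrite gr_mulC. Qed.

Lemma gr_mulEl g1 g2 : gr_mul g1 g2 = \sum_(a <- msupp g1) gr_mul << g1@_a *g a >> g2.
Proof. by apply/eq_bigr=> a _; rewrite gr_mulUg. Qed.

Lemma gr_mulEr g1 g2 : gr_mul g1 g2 = \sum_(b <- msupp g2) gr_mul g1 << g2@_b *g b >>.
Proof. by rewrite gr_mulC gr_mulEl; apply/eq_bigr=> b _; rewrite gr_mulC. Qed.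

Lemma gr_mulA : associative gr_mul.
Proof.
move=> g1 g2 g3.
rewrite (gr_mulEl g1 (gr_mul g2 g3)) (gr_mulEl g1 g2) gr_mul_suml.
apply/eq_bigr=> a _.
rewrite (gr_mulEl g2 g3) (gr_mulEr _ g2) gr_mul_sumr gr_mul_suml.
apply/eq_bigr=> b _.
rewrite (gr_mulEr _ g3) gr_mul_sumr [RHS]gr_mulEr.
by apply/eq_bigr=> c _; rewrite !gr_mulUU mulrA addrA.
Qed.

Lemma gr_mul1l : left_id (gr 0) gr_mul.
Proof.
move=> g; rewrite gr_mulUg [RHS]monalgE.
by apply/eq_bigr=> a _; rewrite mul1r add0r.
Qed.

Lemma gr1_neq0 : gr 0 != 0 :> groupring A.
Proof. by rewrite /gr monalgU_eq0. Qed.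

HB.instance Definition _ := GRing.Zmodule_isComNzRing.Build (groupring A)
  gr_mulA gr_mulC gr_mul1l gr_mulDl gr1_neq0.

End GroupRing.

Section Torsion.
Variable V : zmodType.

Definition torsion : {pred V} := fun x => `[< exists k : nat, (0 < k)%N /\ x *+ k = 0 >].

Lemma torsion_zmod_closed : zmod_closed torsion.
Proof.
split=> [|x y /asboolP[k [k0 xk]] /asboolP[l [l0 yl]]]; apply/asboolP.
  by exists 1%N.
exists (k * l)%N; rewrite muln_gt0 k0 l0; split=> //.
by rewrite mulrnBl mulrnA xk mul0rn mulnC mulrnA yl mul0rn subr0.
Qed.

HB.instance Definition _ := GRing.isZmodClosed.Build V torsion torsion_zmod_closed.
End Torsion.

Section Cokernel.
Variables (R : comNzRingType) (m n : nat) (D : 'M[R]_(m, n)).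

Definition im_mx : {pred 'rV[R]_n} := fun u => `[< exists w : 'rV[R]_m, u = w *m D >].

Lemma im_mx_zmod_closed : zmod_closed im_mx.
Proof.
split=> [|u v /asboolP[w ->] /asboolP[x ->]]; apply/asboolP.
  by exists 0; rewrite mul0mx.
by exists (w - x); rewrite mulmxBl.
Qed.

HB.instance Definition _ := GRing.isZmodClosed.Build 'rV[R]_n im_mx im_mx_zmod_closed.

(* The cokernel of the homomorphism R^m -> R^n, w |-> w *m D, whose value on
   the i-th basis vector is the i-th row of D. *)
Definition coker : Type := Quotient.quot im_mx.

HB.instance Definition _ := GRing.Zmodule.copy coker (Quotient.quot im_mx).

Definition coker_pi (u : 'rV[R]_n) : coker := \pi_(Quotient.quot im_mx)%qT u.

Definition coker_scale (a : R) (x : coker) : coker :=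
  coker_pi (a *: generic_quotient.repr (x : Quotient.quot im_mx)).

Lemma coker_piK x : coker_pi (generic_quotient.repr (x : Quotient.quot im_mx)) = x.
Proof. exact: reprK. Qed.

Lemma coker_piD u v : coker_pi (u + v) = coker_pi u + coker_pi v.
Proof. exact: Quotient.pi_add. Qed.

Lemma coker_eq u v : u - v \in im_mx -> coker_pi u = coker_pi v.
Proof. by rewrite Quotient.idealrBE => /eqP. Qed.

Lemma coker_scale_pi a u : coker_scale a (coker_pi u) = coker_pi (a *: u).
Proof.
apply: coker_eq; rewrite -scalerBr.
have: generic_quotient.repr (coker_pi u : Quotient.quot im_mx) - u \in im_mx.
  by rewrite Quotient.idealrBE; apply/eqP; exact: coker_piK.
by case/asboolP=> w ->; apply/asboolP; exists (a *: w); rewrite scalemxAl.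
Qed.

Lemma coker_scaleA a b x : coker_scale a (coker_scale b x) = coker_scale (a * b) x.
Proof. by rewrite -(coker_piK x) !coker_scale_pi scalerA. Qed.

Lemma coker_scale1 : left_id 1 coker_scale.
Proof. by move=> x; rewrite -(coker_piK x) coker_scale_pi scale1r. Qed.

Lemma coker_scaleDr : right_distributive coker_scale +%R.
Proof.
move=> a x y; rewrite -(coker_piK x) -(coker_piK y) -coker_piD.
by rewrite !coker_scale_pi scalerDr coker_piD.
Qed.

Lemma coker_scaleDl x : {morph coker_scale^~ x : a b / a + b}.
Proof.
by move=> a b; rewrite -(coker_piK x) !coker_scale_pi scalerDl coker_piD.
Qed.

HB.instance Definition _ := GRing.Zmodule_isLmodule.Build R coker
  coker_scaleA coker_scale1 coker_scaleDr coker_scaleDl.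
End Cokernel.

Section Gcd.
Variable R : comNzRingType.

Definition divides (x y : R) : Prop := exists z, y = x * z.

Definition is_gcd (S : R -> Prop) (g : R) : Prop :=
  (forall x, S x -> divides g x) /\
  (forall d, (forall x, S x -> divides d x) -> divides d g).

Definition associated (x y : R) : Prop :=
  exists u v : R, u * v = 1 /\ x = u * y.

Definition max_minor (m n : nat) (D : 'M[R]_(m, n)) (x : R) : Prop :=
  exists f : 'I_n -> 'I_m, {homo f : i j / (i < j)%N} /\ x = \det (rowsub f D).
End Gcd.

(* The vertices of a model tetrahedron are the elements of 'I_4, and the
   ordering 0, 1, 2, 3 is positively oriented, in the sense that
   det (v1 - v0, v2 - v0, v3 - v0) > 0 in an oriented chart.
   The pair (t, v) stands for the face of t opposite to its vertex v. *)
Definition v0 : 'I_4 := @Ordinal 4 0 isT.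
Definition v1 : 'I_4 := @Ordinal 4 1 isT.
Definition v2 : 'I_4 := @Ordinal 4 2 isT.
Definition v3 : 'I_4 := @Ordinal 4 3 isT.

(* The face (t, v) is identified with the face (nbr t v, glue t v v), each
   vertex w <> v of t being identified with the vertex glue t v w; the vertex
   v is sent to the vertex of nbr t v opposite to the common face. *)
Record gluing := Gluing {
  tet :> finType;
  nbr : tet -> 'I_4 -> tet;
  glue : tet -> 'I_4 -> 'S_4
}.

Section Gluing.
Variable G : gluing.

Definition opp_face (x : G * 'I_4) : G * 'I_4 := (nbr x.1 x.2, glue x.1 x.2 x.2).

(* (t, A) with #|A| = 2 is an edge of the tetrahedron t. *)
Definition edge_adj : rel (G * {set 'I_4}) := fun x y =>
  [exists v, (v \notin x.2) && (y == (nbr x.1 v, glue x.1 v @: x.2))].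

Definition edge_class (x : G * {set 'I_4}) : {set G * {set 'I_4}} :=
  [set y | connect edge_adj x y].

(* The edges of the triangulation, each one given as the set of its
   embeddings in tetrahedra. *)
Definition edge : finType :=
  {e : {set G * {set 'I_4}} | e \in [set edge_class x | x : G * {set 'I_4} & #|x.2| == 2]}.

(* A flag (t, q) is a tetrahedron with an ordering q 0, q 1, q 2, q 3 of its
   vertices. Turning around the oriented edge from q 0 to q 1 crosses the
   face opposite to q 2. *)
Definition turn (x : G * 'S_4) : G * 'S_4 :=
  (nbr x.1 (x.2 v2), (tperm v2 v3 * x.2 * glue x.1 (x.2 v2))%g).

(* (t, v) also stands for the truncation triangle of t at the vertex v. *)
Definition corner_adj : rel (G * 'I_4) := fun x y =>
  [exists w, (w != x.2) && (y == (nbr x.1 w, glue x.1 w x.2))].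

Definition link_triangles (c : G * 'I_4) : nat := #|[pred x | connect corner_adj c x]|.

(* The vertices of the link are the ends of the edges, that is the classes
   of oriented edges (the origin being the vertex in the cusp); they are the
   orbits of [turn] on flags whose ordering is positive. *)
Definition link_vertices (c : G * 'I_4) : nat :=
  fcard turn [pred x : G * 'S_4 | ~~ odd_perm x.2 & connect corner_adj c (x.1, x.2 v0)].

(* The link of a vertex is a closed connected surface, oriented because the
   gluing maps are; having 3/2 as many edges as triangles, it is a torus if
   and only if V - (3/2) F + F = 0. *)
Definition toroidal_cusps : Prop :=
  forall c : G * 'I_4, (link_vertices c).*2 = link_triangles c.
End Gluing.

(* The underlying manifold M is the union of the tetrahedra minus their
   vertices, its orientation being that of the labelled tetrahedra. *)
Record ideal_triangulation := IdealTriangulation {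
  it_gluing :> gluing;
  nbrK : forall (t : it_gluing) v, nbr (nbr t v) (glue t v v) = t;
  glueK : forall (t : it_gluing) v, glue (nbr t v) (glue t v v) = (glue t v)^-1%g;
  glue_odd : forall (t : it_gluing) v, odd_perm (glue t v);
  glue_free : forall x : it_gluing * 'I_4, opp_face x != x;
  tet_nonempty : (0 < #|it_gluing|)%N;
  tet_connected : forall t u : it_gluing,
    connect (fun t' u' => [exists v, nbr t' v == u']) t u;
  cusps_toroidal : toroidal_cusps it_gluing
}.

Section Diagonals.
Variables (G : gluing) (out : G -> 'I_4 -> bool).

(* If out t v states that the face opposite to v is cooriented out of t, the
   common edge of the two top faces is spanned by the two vertices that are
   not opposite to a top face. *)
Definition top_diag (t : G) : {set 'I_4} := [set v | ~~ out t v].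
Definition bot_diag (t : G) : {set 'I_4} := [set v | out t v].

(* Dihedral angle at the edge x, in units of pi. *)
Definition angle (x : G * {set 'I_4}) : nat :=
  if (x.2 == top_diag x.1) || (x.2 == bot_diag x.1) then 1 else 0.
End Diagonals.

Record transverse_taut (M : ideal_triangulation) := TransverseTaut {
  out : M -> 'I_4 -> bool;
  out_glue : forall (t : M) v, out (nbr t v) (glue t v v) = ~~ out t v;
  out_two : forall t : M, #|[set v | out t v]| = 2;
  angle_sum : forall e : edge M, (\sum_(x in val e) angle out x)%N = 2
}.

Section TautHomology.
Variables (M : ideal_triangulation) (a : transverse_taut M).

(* A triangle is given by the side from which it is cooriented outwards. *)
Definition face : finType := {x : M * 'I_4 | out a x.1 x.2}.

Definition below (f : face) : M := (val f).1.
Definition above (f : face) : M := nbr (val f).1 (val f).2.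

(* M deformation retracts onto the 2-complex dual to the triangulation. It has
   one vertex for each tetrahedron, one edge for each triangle f, directed by
   the coorientation from below f to above f, and one 2-cell for each edge. *)
Definition chain1 : zmodType := {ffun face -> int}.

Definition bd1 (c : chain1) : {ffun M -> int} :=
  [ffun t => \sum_f c f * ((above f == t)%:Z - (below f == t)%:Z)].

(* The dual edge crossed when leaving x.1 through its face x. *)
Definition cross (x : M * 'I_4) : chain1 :=
  [ffun f => (val f == x)%:Z - (val f == opp_face x)%:Z].

(* The boundary of the 2-cell dual to an edge, both its orientations and all
   starting flags being allowed. *)
Definition bd2 (x : M * 'S_4) : chain1 :=
  \sum_(y <- orbit (@turn M) x) cross (y.1, y.2 v2).

Lemma bd1_is_zmod_morphism : zmod_morphism bd1.
Proof.
move=> c d; apply/ffunP=> t; rewrite !ffunE -sumrB.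
by apply: eq_bigr => f _; rewrite !ffunE mulrBl.
Qed.

HB.instance Definition _ := GRing.isZmodMorphism.Build chain1 {ffun M -> int} bd1
  bd1_is_zmod_morphism.

Definition is_cycle : {pred chain1} := fun c => bd1 c == 0.

Lemma is_cycle_zmod_closed : zmod_closed is_cycle.
Proof.
split=> [|c d /eqP c0 /eqP d0]; apply/eqP; first by rewrite raddf0.
by rewrite raddfB /= c0 d0 subr0.
Qed.

HB.instance Definition _ := GRing.isZmodClosed.Build chain1 is_cycle is_cycle_zmod_closed.

Record cycle1 := Cycle1 { cycle_val :> chain1; cycle_valP : cycle_val \in is_cycle }.
HB.instance Definition _ := [isSub for cycle_val].
HB.instance Definition _ := [Choice of cycle1 by <:].
HB.instance Definition _ := [SubChoice_isSubZmodule of cycle1 by <:].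

Definition is_boundary : {pred cycle1} := fun z =>
  `[< exists n : M * 'S_4 -> int, val z = \sum_x bd2 x *~ n x >].

Lemma is_boundary_zmod_closed : zmod_closed is_boundary.
Proof.
split=> [|y z /asboolP[k yk] /asboolP[l zl]]; apply/asboolP.
  by exists (fun=> 0); rewrite raddf0 big1.
exists (fun x => k x - l x); rewrite raddfB /= yk zl -sumrB.
by apply: eq_bigr => x _; rewrite mulrzBr.
Qed.

HB.instance Definition _ := GRing.isZmodClosed.Build cycle1 is_boundary
  is_boundary_zmod_closed.

Definition H1 : zmodType := Quotient.quot is_boundary.
Definition H : zmodType := Quotient.quot (@torsion H1).

Definition hclass (z : cycle1) : H :=
  \pi_(Quotient.quot (@torsion H1))%qT (\pi_(Quotient.quot is_boundary)%qT z).

(* A lift to M^ab of the tetrahedron t is given by a path in the dual graph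
   from a base tetrahedron to t, up to homology modulo torsion, hence by a
   chain with boundary t - base. *)
Record lifts := Lifts {
  base : M;
  lift : M -> chain1;
  lift_bd : forall t, bd1 (lift t) = [ffun u => (t == u)%:Z - (base == u)%:Z]
}.

Section Lifts.
Variable L : lifts.

Lemma hol_cycle (f : face) :
  lift L (below f) + cross (val f) - lift L (above f) \in is_cycle.
Proof.
apply/eqP; rewrite raddfB raddfD /= !lift_bd.
have -> : bd1 (cross (val f)) = [ffun u => (above f == u)%:Z - (below f == u)%:Z].
  apply/ffunP=> u; rewrite !ffunE (bigD1 f) //= [X in _ + X]big1 ?addr0.
    by rewrite !ffunE eqxx eq_sym (negPf (glue_free (val f))) subr0 mul1r.
  move=> g gf; rewrite !ffunE (inj_eq val_inj) (negPf gf) sub0r.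
  suff -> : (val g == opp_face (val f)) = false by rewrite oppr0 mul0r.
  apply/negP=> /eqP gE; have := valP g; rewrite gE /opp_face /= out_glue.
  by rewrite (valP f).
apply/ffunP=> u; rewrite !ffunE.
by lia.
Qed.

(* Going up through f from the chosen lift of [below f] leads to the
   translate by [hol f] of the chosen lift of [above f]. *)
Definition hol (f : face) : H := hclass (Cycle1 (hol_cycle f)).

Definition lift_adj : rel M := fun t u =>
  [exists f : face, (hol f == 0) &&
    [|| (below f == t) && (above f == u) | (below f == u) && (above f == t)]].
End Lifts.

(* A fundamental domain consisting of one lift 1.t of each tetrahedron t,
   connected through lifts of triangles. *)
Record fundamental_domain := FundamentalDomain {
  fd_lifts :> lifts;
  fd_connected : forall t u : M, connect (lift_adj fd_lifts) t u
}.

End TautHomology.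

Inductive colour := Red | Blue.

(* View t from above with top diagonal {q 0, q 1}, drawn vertically with q 0 at
   the top, and bottom diagonal {q 2, q 3}, drawn horizontally with q 2 on the
   left. With the first two vertices nearer to the viewer, this picture
   requires the ordering q to be positive. *)
Record veering (M : ideal_triangulation) (a : transverse_taut M) := Veering {
  nu : edge M -> colour;
  nuP : forall (t : M) (q : 'S_4),
    ~~ odd_perm q ->
    top_diag (out a) t = [set q v0; q v1] ->
    bot_diag (out a) t = [set q v2; q v3] ->
    forall e : edge M,
      [/\ (t, [set q v2; q v0]) \in val e -> nu e = Red,
          (t, [set q v1; q v3]) \in val e -> nu e = Red,
          (t, [set q v0; q v3]) \in val e -> nu e = Blue
        & (t, [set q v2; q v1]) \in val e -> nu e = Blue]
}.

Section TautModules.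
Variables (M : ideal_triangulation) (a : transverse_taut M).
Variable D : fundamental_domain a.

Local Notation H := (H a).
Local Notation ZH := (groupring H).

(* Leaving h.t through its face x = (t, v) leads to (h + cross_hol x).t'. *)
Definition cross_hol (x : M * 'I_4) : H := \sum_f hol D f *~ cross a x f.

(* ((h, t), A) is the edge A of the tetrahedron h.t of the cover. Two of them
   are related when they are the same edge of V^ab. *)
Inductive same_lift : (H * M) * {set 'I_4} -> (H * M) * {set 'I_4} -> Prop :=
| same_lift_refl x : same_lift x x
| same_lift_cross x h t A v : same_lift x ((h, t), A) -> v \notin A ->
    same_lift x ((h + cross_hol (t, v), nbr t v), glue t v @: A).

(* The H-coefficient of the edge A of 1.t: the edge is the top diagonal of a
   unique tetrahedron of the cover, the one immediately below it. *)
Definition edge_coeff (t : M) (A : {set 'I_4}) : H :=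
  xget 0 [set h | exists u : M, same_lift ((0, t), A) ((h, u), top_diag (out a) u)]%classic.

(* The triangle 1.f is the face opposite to (val f).2 of the tetrahedron
   1.(below f), in which its edges are described here. *)
Definition lower_large (f : face a) (A : {set 'I_4}) : bool :=
  A == top_diag (out a) (below f).

Definition upper_large (f : face a) (A : {set 'I_4}) : bool :=
  glue (below f) (val f).2 @: A == bot_diag (out a) (above f).

(* The homomorphism Z[H]^F -> Z[H]^E sending 1.f to x0 - x1 - x2, where x0 is
   the edge of 1.f selected by [large], in the convention of row vectors. *)
Definition taut_mx (large : face a -> {set 'I_4} -> bool) : 'M[ZH]_(#|face a|, #|edge M|) :=
  \matrix_(i, j) let f : face a := enum_val i in let e : edge M := enum_val j in
    \sum_(A : {set 'I_4} | [&& #|A| == 2, (val f).2 \notin A & (below f, A) \in val e])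
      (if large f A then 1 else -1) * gr (edge_coeff (below f) A).

Definition DL := taut_mx lower_large.
Definition DU := taut_mx upper_large.

Definition lower_taut_module : lmodType ZH := coker DL.
Definition upper_taut_module : lmodType ZH := coker DU.

(* Taut polynomials are only defined up to a unit, hence the relations. *)
Definition is_lower_taut_poly (p : ZH) : Prop := is_gcd (max_minor DL) p.
Definition is_upper_taut_poly (p : ZH) : Prop := is_gcd (max_minor DU) p.
End TautModules.

(* Main.v *)
Require Import Defs.
From HB Require Import structures.
From mathcomp Require Import all_boot all_order fingroup perm all_algebra.
From mathcomp Require Import finmap.
From mathcomp.multinomials Require Import monalg.
From mathcomp Require Import boolp.

(** The matrices of D^L and D^U differ only by signs of rows and columns.

    In a tetrahedron a face consists of a diagonal and of two equatorial edges,
    one red and one blue. Hence each triangle f of a veering triangulation has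
    two edges of one colour c and one edge y of the other colour, and both its
    large edges are among the two c-coloured ones: removing a large edge leaves
    edges of different colours. The orientation of M shows more. Seen from
    above, the pictures of f in the tetrahedra below and above it force the
    cyclic anticlockwise order y, lower large edge x, upper large edge x'
    ([large_edges_colour]); in particular x and x' are distinct. Thus
    D^L(f) = x - x' - y and D^U(f) = x' - x - y. Changing the sign of all red
    edges turns one of these expressions into the other up to a sign that
    depends on c ([taut_mx_sign_conj]). The H-coefficients of the edges of f are
    the same in both expressions, so this change of signs, an automorphism of
    Z[H]^E, maps the image of D^L onto that of D^U and induces the isomorphism
    of cokernels ([sign_conj_coker_iso]).

    For the polynomials, the maximal minors of both matrices agree up to signs
    ([sign_conj_minor]), so any two greatest common divisors divide each other.
    That they differ by a unit follows once Z[H] is known to have no zero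
    divisors ([groupring_integral]). This holds because H is torsion free: the
    finitely many group elements relevant to a product can be compared by a
    translation invariant order, and the product of leading terms does not
    cancel. *)

Set Implicit Arguments.
Unset Strict Implicit.
Unset Printing Implicit Defensive.

Import GRing.Theory.
Local Open Scope ring_scope.

(** * Group rings of torsion free abelian groups *)

Section Cones.
Variable A : zmodType.

(** The nonnegative elements of a translation invariant partial order on A. *)
Definition is_cone (P : A -> Prop) : Prop :=
  [/\ P 0, forall x y, P x -> P y -> P (x + y) & forall x, P x -> P (- x) -> x = 0].

Definition torsion_free : Prop :=
  forall (x : A) k, (0 < k)%N -> x *+ k = 0 -> x = 0.

Definition cone_adjoin (P : A -> Prop) (x y : A) : Prop :=
  exists p n, P p /\ y = p + x *+ n.

Lemma cone_mulrn P x n : is_cone P -> P x -> P (x *+ n).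
Proof.
case=> P0 PD _ Px; elim: n => [|n IHn]; first by rewrite mulr0n.
by rewrite mulrS; apply: PD.
Qed.

Lemma cone_adjoin_pointed P x : is_cone P ->
  (forall n, (0 < n)%N -> ~ P (- (x *+ n))) -> is_cone (cone_adjoin P x).
Proof.
move=> [P0 PD PN] nPx; split.
- by exists 0, 0%N; rewrite mulr0n addr0.
- move=> _ _ [p [n [Pp ->]]] [q [m [Pq ->]]].
  by exists (p + q), (n + m)%N; split; [apply: PD | rewrite mulrnDr addrACA].
- move=> y [p [n [Pp yE]]] [q [m [Pq NyE]]].
  have pqE : p + q = - (x *+ (n + m)).
    apply/eqP; rewrite -addr_eq0 mulrnDr addrACA -yE -NyE; exact/eqP/subrr.
  have [nm0|nm0] := posnP (n + m); last first.
    by case: (nPx _ nm0); rewrite -pqE; apply: PD.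
  move: pqE; rewrite nm0 mulr0n oppr0 => /eqP; rewrite addr_eq0 => /eqP pE.
  have p0 : p = 0 by apply: PN => //; rewrite pE opprK.
  move/eqP: nm0; rewrite addn_eq0 => /andP[/eqP n0 _].
  by rewrite yE p0 n0 mulr0n addr0.
Qed.

(** One of x and - x can always be made nonnegative: if neither P + N x nor
    P - N x is pointed, then - n x and m x lie in P for some n, m > 0, so that
    both m n x and its opposite do, and x = 0 as A is torsion free. *)
Lemma cone_extend P x : torsion_free -> is_cone P ->
  exists Q, [/\ is_cone Q, forall y, P y -> Q y & Q x \/ Q (- x)].
Proof.
move=> tf Pcone; have [P0 PD PN] := Pcone.
have adjoined z : (forall n, (0 < n)%N -> ~ P (- (z *+ n))) ->
    exists Q, [/\ is_cone Q, forall y, P y -> Q y & Q z].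
  move=> nP; exists (cone_adjoin P z); split; first exact: cone_adjoin_pointed.
    by move=> y Py; exists y, 0%N; rewrite mulr0n addr0.
  by exists 0, 1%N; rewrite add0r.
have [/adjoined[Q [Qc PQ Qx]]|] :=
  pselect (forall n, (0 < n)%N -> ~ P (- (x *+ n))); first by exists Q; split; auto.
have [/adjoined[Q [Qc PQ Qx]] _|] :=
  pselect (forall n, (0 < n)%N -> ~ P (- ((- x) *+ n))).
  by exists Q; split; auto.
move=> /existsNP[m /not_implyP[m0 /contrapT Pm]].
move=> /existsNP[n /not_implyP[n0 /contrapT Pn]].
rewrite mulNrn opprK in Pm.
suff x0 : x = 0 by exists P; split=> //; left; rewrite x0.
apply: (tf x (m * n)%N); first by rewrite muln_gt0 m0 n0.
apply: PN; first by rewrite mulrnA; apply: cone_mulrn.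
by rewrite mulnC mulrnA -mulNrn; apply: cone_mulrn.
Qed.

(** A product of two given elements of Z[A] involves finitely many
    differences of exponents, so this finite version replaces the theorem that
    every torsion free abelian group is orderable. *)
Lemma cone_comparing (s : seq A) : torsion_free ->
  exists P, is_cone P /\ {in s, forall x, P x \/ P (- x)}.
Proof.
move=> tf; elim: s => [|x s [P [Pcone Ps]]].
  by exists (fun x => x = 0); split=> //; split=> // x y -> ->; rewrite addr0.
have [Q [Qcone PQ Qx]] := cone_extend x tf Pcone.
exists Q; split=> // y; rewrite inE => /predU1P[->//|/Ps[] /PQ]; auto.
Qed.

Lemma cone_max P (s : seq A) : is_cone P -> s != [::] ->
  {in s &, forall x y, P (x - y) \/ P (- (x - y))} ->
  exists2 m, m \in s & {in s, forall x, P (m - x)}.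
Proof.
move=> [P0 PD _]; elim: s => //= x [_ _ _|y s IHs _ cmp].
  by exists x; rewrite ?mem_head // => z; rewrite inE => /eqP->; rewrite subrr.
have [//|z w zs ws|m ms mP] := IHs; first by apply: cmp; rewrite inE ?zs ?ws orbT.
have [xm|] := cmp x m (mem_head _ _) (mem_behead (s:=_::_) ms); last rewrite opprB => mx.
  exists x; rewrite ?mem_head // => z; rewrite inE => /predU1P[->|/mP mz].
    by rewrite subrr.
  by rewrite -(subrKA m); apply: PD.
exists m; first by rewrite inE ms orbT.
by move=> z; rewrite inE => /predU1P[->|/mP].
Qed.

Lemma mcoeff_gr_mul (f g : groupring A) c :
  (f * g)@_c = \sum_(a <- msupp f) \sum_(b <- msupp g) (f@_a * g@_b) *+ (a + b == c).
Proof.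
rewrite [f * g]/(gr_mul f g) /gr_mul raddf_sum; apply: eq_bigr => a _.
by rewrite raddf_sum; apply: eq_bigr => b _; rewrite /= mcoeffU.
Qed.

Lemma msupp_neq_nil (f : groupring A) : f != 0 -> (msupp f : seq A) != [::].
Proof.
apply: contraNneq => f0; apply/eqP/malgP => a; rewrite mcoeff0.
apply: mcoeff_outdom; have: a \notin (msupp f : seq A) by rewrite f0.
  by [].
Qed.

(** Order the finitely many exponents that occur. If m and k are the largest
    exponents of f and g, then m + k arises from no other pair of exponents,
    whence its coefficient in f * g is f@_m * g@_k, which is not zero. *)
Lemma groupring_integral (f g : groupring A) :
  torsion_free -> f * g = 0 -> (f == 0) || (g == 0).
Proof.
move=> tf fg0; apply: contraT; rewrite negb_or => /andP[f0 g0].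
pose diffs := fun h : groupring A => [seq x - y | x <- msupp h, y <- msupp h].
have [P [Pcone Pd]] := cone_comparing (diffs f ++ diffs g) tf.
have [m mf mmax] : exists2 m, m \in (msupp f : seq A) &
    {in (msupp f : seq A), forall x, P (m - x)}.
  apply: cone_max => //; first exact: msupp_neq_nil.
  by move=> x y xf yf; apply: Pd; rewrite mem_cat; apply/orP; left; apply: allpairs_f.
have [k kg kmax] : exists2 k, k \in (msupp g : seq A) &
    {in (msupp g : seq A), forall x, P (k - x)}.
  apply: cone_max => //; first exact: msupp_neq_nil.
  by move=> x y xf yf; apply: Pd; rewrite mem_cat; apply/orP; right; apply: allpairs_f.
have uniq_sum a b : a \in (msupp f : seq A) -> b \in (msupp g : seq A) ->
    (a + b == m + k) = (a == m) && (b == k).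
  move=> af bg; apply/eqP/andP => [abE|[/eqP-> /eqP->]//].
  have [_ _ PN] := Pcone.
  have maE : m - a = b - k by apply/eqP; rewrite subr_eq addrAC eq_sym subr_eq addrC abE.
  have ma0 : m - a = 0.
    by apply: PN; [apply: mmax | rewrite maE opprB; apply: kmax].
  by split; [rewrite eq_sym|]; rewrite -subr_eq0 -?maE ma0.
have /eqP := congr1 (mcoeff (m + k)) fg0.
rewrite mcoeff0 mcoeff_gr_mul (bigD1_seq m mf (fset_uniq _)) /=.
rewrite (bigD1_seq k kg (fset_uniq _)) /=.
rewrite eqxx mulr1n big1_seq => [|b /andP[bk bg]]; last first.
  by rewrite uniq_sum // (negPf bk) andbF.
rewrite addr0 big1_seq => [|a /andP[am af]]; last first.
  by rewrite big1_seq // => b /andP[_ bg]; rewrite uniq_sum // (negPf am).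
rewrite addr0 mulf_eq0 !mcoeff_eq0.
by move: mf kg => /= -> ->.
Qed.
End Cones.

Lemma quot_torsion_free (V : zmodType) : torsion_free (Quotient.quot (@torsion V)).
Proof.
have pi0 (w : V) :
    (\pi_(Quotient.quot (@torsion V))%qT w == 0) = (w \in @torsion V).
  rewrite -[w in RHS]subr0 Quotient.idealrBE; congr (_ == _).
  by symmetry; apply: raddf0.
move=> x k k0; rewrite -[x]reprK -raddfMn /=.
move=> /eqP; rewrite pi0 => /asboolP[l [l0 ul]].
apply/eqP; rewrite pi0; apply/asboolP.
by exists (k * l)%N; rewrite muln_gt0 k0 l0 mulrnA.
Qed.

(** * Linear maps between cokernels *)

Section CokerMap.
Variables (R : comNzRingType) (m m' n n' : nat).
Variables (D : 'M[R]_(m, n)) (D' : 'M[R]_(m', n')).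

Definition coker_map (P : 'M[R]_(n, n')) (x : coker D) : coker D' :=
  coker_pi D' (generic_quotient.repr (x : Quotient.quot (@im_mx _ _ _ D)) *m P).

Variables (P : 'M[R]_(n, n')) (Q : 'M[R]_(m, m')).
Hypothesis DP : D *m P = Q *m D'.

(** The relation D *m P = Q *m D' makes P map the image of D into that of D',
    so the value does not depend on the representative. *)
Lemma coker_map_pi u : coker_map P (coker_pi D u) = coker_pi D' (u *m P).
Proof.
apply: coker_eq; rewrite -mulmxBl.
have: generic_quotient.repr (coker_pi D u : Quotient.quot (@im_mx _ _ _ D)) - u
    \in @im_mx _ _ _ D.
  by rewrite Quotient.idealrBE; apply/eqP; exact: coker_piK.
case/asboolP=> w ->; apply/asboolP; exists (w *m Q).
by rewrite -!mulmxA DP.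
Qed.

Lemma coker_map_linear : linear (coker_map P).
Proof.
move=> c x y; rewrite -(coker_piK x) -(coker_piK y).
rewrite [c *: _]coker_scale_pi -coker_piD !coker_map_pi mulmxDl coker_piD.
by rewrite -scalemxAl -coker_scale_pi.
Qed.
End CokerMap.

Lemma coker_linear_iso (R : comNzRingType) (m n : nat) (D D' : 'M[R]_(m, n))
    (P P' : 'M[R]_n) (Q Q' : 'M[R]_m) :
  D *m P = Q *m D' -> D' *m P' = Q' *m D -> P *m P' = 1%:M -> P' *m P = 1%:M ->
  exists phi : {linear coker D -> coker D'}, bijective phi.
Proof.
move=> DP DP' PP' P'P.
pose phi := HB.pack_for {linear coker D -> coker D'} (coker_map D' P)
  (GRing.isLinear.Build _ _ _ _ _ (coker_map_linear DP)).
exists phi; exists (coker_map D P') => x.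
  by rewrite -(coker_piK x) /= (coker_map_pi DP) (coker_map_pi DP') -mulmxA PP' mulmx1.
by rewrite -(coker_piK x) /= (coker_map_pi DP') (coker_map_pi DP) -mulmxA P'P mulmx1.
Qed.

(** * Matrices that differ by signs of rows and columns *)

Section Signs.
Variables (R : comNzRingType) (m n : nat) (D D' : 'M[R]_(m, n)).
Variables (r : 'I_m -> bool) (s : 'I_n -> bool).
Hypothesis DE : forall i j, D' i j = (-1) ^+ r i * D i j * (-1) ^+ s j.

Lemma sign_conj_sym i j : D i j = (-1) ^+ r i * D' i j * (-1) ^+ s j.
Proof.
by rewrite DE -!mulrA -signr_addb addbb mulr1 mulrA -signr_addb addbb mul1r.
Qed.

Definition sign_mx k (b : 'I_k -> bool) : 'M[R]_k := diag_mx (\row_i (-1) ^+ b i).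

Lemma sign_mx_sq k (b : 'I_k -> bool) : sign_mx b *m sign_mx b = 1%:M.
Proof.
apply/matrixP=> i j; rewrite mul_diag_mx !mxE.
by case: eqP => [->|_]; rewrite ?mulr0 // -signr_addb addbb.
Qed.

Lemma sign_mx_conj : D *m sign_mx s = sign_mx r *m D'.
Proof.
apply/matrixP=> i j; rewrite mul_mx_diag mul_diag_mx !mxE DE.
by rewrite !mulrA -signr_addb addbb mul1r.
Qed.

(** A minor keeps all the columns, so it is multiplied by all the column signs
    and by the signs of the selected rows. *)
Lemma sign_conj_minor x : max_minor D x -> max_minor D' x \/ max_minor D' (- x).
Proof.
move=> [f [f_homo ->]].
pose b := (\big[addb/false]_i r (f i)) (+) (\big[addb/false]_j s j).
suff detE : \det (rowsub f D') = (-1) ^+ b * \det (rowsub f D).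
  case: b detE => detE; [right | left]; exists f; split=> //.
    by rewrite detE mulN1r.
  by rewrite detE mul1r.
have -> : rowsub f D' = sign_mx (r \o f) *m rowsub f D *m sign_mx s.
  by apply/matrixP=> i j; rewrite mul_mx_diag mul_diag_mx !mxE DE.
rewrite !det_mulmx !det_diag mulrAC /b signr_addb; congr (_ * _ * _).
  by rewrite (big_morph _ (signr_addb R) (erefl _)); apply: eq_bigr => i _; rewrite mxE.
by rewrite (big_morph _ (signr_addb R) (erefl _)); apply: eq_bigr => i _; rewrite mxE.
Qed.
End Signs.

Lemma sign_conj_coker_iso (R : comNzRingType) (m n : nat) (D D' : 'M[R]_(m, n))
    (r : 'I_m -> bool) (s : 'I_n -> bool) :
  (forall i j, D' i j = (-1) ^+ r i * D i j * (-1) ^+ s j) ->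
  exists phi : {linear coker D -> coker D'}, bijective phi.
Proof.
move=> DE; apply: (coker_linear_iso (sign_mx_conj DE) (sign_mx_conj (sign_conj_sym DE)));
  exact: sign_mx_sq.
Qed.

(** An entry of a taut matrix is a sum of this form, over the embeddings of an
    edge in a triangle, with u or l telling which of them are large. *)
Lemma signed_sum (R : comNzRingType) (I : finType) (P : pred I) (u l : I -> bool)
    (c : I -> R) (b s : bool) :
  (forall x, P x -> u x (+) l x = s (+) b) ->
  \sum_(x | P x) (if u x then 1 else -1) * c x =
    (-1) ^+ b * (\sum_(x | P x) (if l x then 1 else -1) * c x) * (-1) ^+ s.
Proof.
move=> ul; rewrite mulr_sumr mulr_suml; apply: eq_bigr => x /ul.
rewrite mulrA mulrAC => ulx {ul}; congr (_ * _).
case: (u x) (l x) s b ulx => [] [] [] [] //= _;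
  by rewrite ?(mulrN, mulNr, mulr1, opprK, expr0, expr1).
Qed.

(** * Greatest common divisors *)

(** Signs do not affect common divisors, so x and y divide each other;
    cancellation in the domain R then makes the quotients inverse units. *)
Lemma gcd_associated (R : comNzRingType) (S T : R -> Prop) (x y : R) :
  (forall a b : R, a * b = 0 -> (a == 0) || (b == 0)) ->
  (forall a, S a -> T a \/ T (- a)) -> (forall a, T a -> S a \/ S (- a)) ->
  is_gcd S x -> is_gcd T y -> associated x y.
Proof.
move=> idR ST TS [xS xmax] [yT ymax].
have dvdN (a b : R) : divides a (- b) -> divides a b.
  by move=> [z bE]; exists (- z); rewrite mulrN -bE opprK.
have [w xE] : divides y x by apply: xmax => a /ST[] /yT // /dvdN.
have [z yE] : divides x y by apply: ymax => a /TS[] /xS // /dvdN.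
have [x0|x_neq0] := eqVneq x 0.
  by exists 1, 1; rewrite mul1r mul1r yE x0 mul0r.
exists w, z; split; last by rewrite mulrC.
apply/eqP; rewrite -subr_eq0.
have /idR : x * (w * z - 1) = 0.
  by rewrite mulrBr mulr1 [w * z]mulrC mulrA -yE -xE subrr.
by rewrite (negPf x_neq0).
Qed.

(** * Orderings of the vertices and edges of tetrahedra *)

Lemma I4P (i : 'I_4) : [\/ i = v0, i = v1, i = v2 | i = v3].
Proof.
by case: i => [[|[|[|[|//]]]] lti];
  [apply: Or41 | apply: Or42 | apply: Or43 | apply: Or44]; apply: val_inj.
Qed.

(** The composite of r with the transposition of v1 and v3 is even and fixes
    v3, hence is the identity or a cyclic permutation of the other three. *)
Lemma odd_perm4_v3_v1 (r : 'S_4) : odd_perm r -> r v3 = v1 ->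
  [\/ [/\ r v0 = v0, r v1 = v3 & r v2 = v2],
      [/\ r v0 = v3, r v1 = v2 & r v2 = v0]
    | [/\ r v0 = v2, r v1 = v0 & r v2 = v3]].
Proof.
move=> r_odd r3.
have cycle_even (x y z w : 'I_4) : x != y -> z != w ->
      r = (tperm x y * tperm z w)%g -> False.
  by move=> xy zw rE; move: r_odd; rewrite rE odd_permM !odd_tperm xy zw.
have r_neq (i j : 'I_4) : i != j -> r i != r j by rewrite (inj_eq perm_inj).
have eq4 (s : 'S_4) : r v0 = s v0 -> r v1 = s v1 -> r v2 = s v2 -> r v3 = s v3 -> r = s.
  by move=> ????; apply/permP=> i; case: (I4P i) => ->.
have := (r_neq v0 v3 isT, r_neq v1 v3 isT, r_neq v2 v3 isT,
         r_neq v0 v1 isT, r_neq v0 v2 isT, r_neq v1 v2 isT).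
rewrite r3; case: (I4P (r v0)) (I4P (r v1)) (I4P (r v2)) => r0 [] r1 [] r2;
  rewrite r0 r1 r2 => -[[[[[]]]]] //; move=> *;
  try (by [apply: Or31 | apply: Or32 | apply: Or33]); exfalso.
- by apply: (@cycle_even v1 v2 v1 v3) => //; apply: eq4; rewrite ?r0 ?r1 ?r2 ?r3 permM !permE.
- by apply: (@cycle_even v0 v2 v1 v3) => //; apply: eq4; rewrite ?r0 ?r1 ?r2 ?r3 permM !permE.
- by apply: (@cycle_even v0 v3 v0 v1) => //; apply: eq4; rewrite ?r0 ?r1 ?r2 ?r3 permM !permE.
Qed.

(** With S the bottom diagonal of a tetrahedron, this is an ordering as in the
    definition of a veering structure, in which moreover the vertex v of the
    bottom diagonal is drawn on the right: if the picture has the wrong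
    orientation, the ends of the top diagonal are exchanged. *)
Lemma even_ordering (S : {set 'I_4}) v : #|S| = 2 -> v \in S ->
  exists q : 'S_4,
    [/\ ~~ odd_perm q, ~: S = [set q v0; q v1], S = [set q v2; q v3] & q v3 = v].
Proof.
move=> S2 vS.
have [w Sw] : exists w, S :\ v = [set w].
  by apply/cards1P; rewrite -(eqn_add2l (v \in S)) -cardsD1 S2 vS.
have SE : S = [set w; v] by rewrite setUC -(setD1K vS) Sw.
have wv : w != v by move: (set11 w); rewrite -Sw !inE => /andP[].
have /eqP/cards2P[x [y [xy SC]]] : #|~: S| = 2%N.
  by apply/eqP; rewrite -(eqn_add2l #|S|) cardsC card_ord S2.
have [xS yS] : x \notin S /\ y \notin S by split; rewrite -in_setC SC !inE eqxx ?orbT.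
have t_uniq : uniq [tuple x; y; w; v].
  move: xS yS; rewrite SE /= !inE !negb_or => /andP[-> ->] /andP[-> ->].
  by rewrite xy wv.
pose q : 'S_4 := perm (elimT (tuple_uniqP _) t_uniq).
have [q0 q1 q2 q3] : [/\ q v0 = x, q v1 = y, q v2 = w & q v3 = v] by rewrite !permE.
case odd_q: (odd_perm q); last by exists q; rewrite odd_q q0 q1 q2 q3.
exists (tperm v0 v1 * q)%g; rewrite odd_permM odd_tperm odd_q.
have -> : (tperm v0 v1 * q)%g v0 = y by rewrite permM tpermL.
have -> : (tperm v0 v1 * q)%g v1 = x by rewrite permM tpermR.
have -> : (tperm v0 v1 * q)%g v2 = w by rewrite permM tpermD.
have -> : (tperm v0 v1 * q)%g v3 = v by rewrite permM tpermD.
by rewrite SC [in LHS]setUC.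
Qed.

Lemma set2_neq (T : finType) (x y k l : T) : y != k -> y != l ->
  ([set x; y] == [set k; l]) = false.
Proof.
move=> yk yl; apply/negP => /eqP/setP/(_ y).
by rewrite !inE eqxx orbT (negPf yk) (negPf yl).
Qed.

Section Edges.
Variable G : gluing.

Lemma mem_edge_cross (e : edge G) (t : G) (S : {set 'I_4}) v :
  v \notin S -> (t, S) \in val e -> (nbr t v, glue t v @: S) \in val e.
Proof.
move=> vS; case/imsetP: (valP e) => x _ ->; rewrite !inE => /connect_trans; apply.
by apply/connect1/existsP; exists v; rewrite vS eqxx.
Qed.

Lemma exists_edge (t : G) (S : {set 'I_4}) : #|S| = 2 ->
  exists e : edge G, (t, S) \in val e.
Proof.
move=> S2.
have eP : edge_class (t, S) \in [set edge_class x | x : G * {set 'I_4} & #|x.2| == 2].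
  by apply: imset_f; rewrite inE /= S2.
by exists (@exist _ (fun e => e \in _) (edge_class (t, S)) eP); rewrite inE connect0.
Qed.
End Edges.

(** * Signs of the taut matrices *)

Section Taut.
Variables (M : ideal_triangulation) (a : transverse_taut M) (V : veering a).

Definition is_red (e : edge M) : bool := if nu V e is Red then true else false.

(** The top face opposite to v is then the left half of the drawn
    quadrilateral. *)
Lemma top_face_ordering (t : M) v : out a t v -> exists q : 'S_4,
  [/\ ~~ odd_perm q, top_diag (out a) t = [set q v0; q v1],
      bot_diag (out a) t = [set q v2; q v3] & q v3 = v].
Proof.
move=> tv; have vS : v \in bot_diag (out a) t by rewrite inE.
have [q [q_even top bot qv]] := even_ordering (out_two a t) vS.
by exists q; split=> //; rewrite -top; apply/setP=> x; rewrite !inE.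
Qed.

(** The bottom face opposite to v is then the upper half of the drawn
    quadrilateral. The roles of the diagonals in [even_ordering] are exchanged
    by an even permutation. *)
Lemma bottom_face_ordering (t : M) v : ~~ out a t v -> exists q : 'S_4,
  [/\ ~~ odd_perm q, top_diag (out a) t = [set q v0; q v1],
      bot_diag (out a) t = [set q v2; q v3] & q v1 = v].
Proof.
move=> tv; have vS : v \in top_diag (out a) t by rewrite inE.
have S2 : #|top_diag (out a) t| = 2%N.
  apply/eqP; rewrite -(eqn_add2l #|bot_diag (out a) t|).
  have -> : top_diag (out a) t = ~: bot_diag (out a) t by apply/setP=> x; rewrite !inE.
  by rewrite cardsC card_ord (out_two a t).
have [q [q_even bot top qv]] := even_ordering S2 vS.
pose s : 'S_4 := (tperm v0 v2 * tperm v1 v3)%g.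
have [s0 s1 s2 s3] : [/\ s v0 = v2, s v1 = v3, s v2 = v0 & s v3 = v1].
  by rewrite !permE /= !permE.
exists (s * q)%g; rewrite !(permM s) s0 s1 s2 s3 !odd_permM !odd_tperm.
by split=> //; rewrite -bot; apply/setP=> x; rewrite !inE negbK.
Qed.

(** Two edges of the triangle f have the same colour c, and the third one has
    the other colour. Both large edges have the colour c, because the other two
    edges have different colours. They are distinct: going around f from the
    edge that is not c-coloured, in the direction that is anticlockwise when
    seen from above, the lower large edge comes first and the upper large one
    next. Hence an edge is exactly one of lower large and upper large if it is
    c-coloured, and neither otherwise; b tells whether c is blue. *)
Lemma large_edges_colour (f : face a) :
  exists b : bool, forall (e : edge M) (S : {set 'I_4}),
  #|S| = 2 -> (val f).2 \notin S -> (below f, S) \in val e ->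
  upper_large f S (+) lower_large f S = is_red e (+) b.
Proof.
set t := below f; set v := (val f).2; set g := glue t v.
have [q [q_even q_top q_bot qv]] := top_face_ordering (valP f).
have q3 : q v3 = v by [].
(* In the tetrahedron above, f is a bottom face. *)
have above_v : ~~ out a (above f) (g v) by rewrite out_glue negbK (valP f).
have [q' [q'_even q'_top q'_bot q'1]] := bottom_face_ordering above_v.
(* The gluing of f in terms of both orderings. *)
pose r := (q * g * q'^-1)%g.
have rE i : g (q i) = q' (r i) by rewrite !permM permKV.
(* Gluing maps reverse the orientation. *)
have r_odd : odd_perm r.
  by rewrite !odd_permM odd_permV (negPf q_even) (negPf q'_even) glue_odd.
have r3 : r v3 = v1 by apply: (@perm_inj _ q'); rewrite -rE q3 q'1.
have below_col (e : edge M) :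
    ((t, [set q v0; q v2]) \in val e -> is_red e = true) /\
    ((t, [set q v1; q v2]) \in val e -> is_red e = false).
  have [red _ _ blue] := nuP V q_even q_top q_bot e.
  by split; rewrite setUC /is_red; [move=> /red -> | move=> /blue ->].
have above_col (e : edge M) :
    ((above f, [set q' v0; q' v2]) \in val e -> is_red e = true) /\
    ((above f, [set q' v0; q' v3]) \in val e -> is_red e = false).
  have [red _ blue _] := nuP V q'_even q'_top q'_bot e.
  by split; rewrite /is_red; [rewrite setUC => /red -> | move=> /blue ->].
have glueE i j : g @: [set q i; q j] = [set q' (r i); q' (r j)].
  by rewrite imsetU !imset_set1 !rE.
have q_neq i j : i != j -> q i != q j by rewrite (inj_eq perm_inj).
have crossE (e : edge M) i j : (t, [set q i; q j]) \in val e -> i != v3 -> j != v3 ->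
    (above f, [set q' (r i); q' (r j)]) \in val e.
  move=> et i3 j3; rewrite -glueE; apply: (@mem_edge_cross _ e t _ v) => //.
  by rewrite -q3 !inE negb_or !q_neq 1?eq_sym.
have q'_neq i j : i != j -> q' i != q' j by rewrite (inj_eq perm_inj).
pose agree b i j := forall e : edge M, (t, [set q i; q j]) \in val e ->
  ([set q' (r i); q' (r j)] == [set q' v2; q' v3]) (+)
  ([set q i; q j] == [set q v0; q v1]) = is_red e (+) b.
have face_edges b : agree b v0 v1 -> agree b v0 v2 -> agree b v1 v2 ->
    forall (e : edge M) (S : {set 'I_4}),
      #|S| = 2 -> v \notin S -> (t, S) \in val e ->
      upper_large f S (+) lower_large f S = is_red e (+) b.
  move=> H01 H02 H12 e S /eqP/cards2P[x [y [xy ->]]].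
  rewrite /upper_large /lower_large q_top q'_bot -/t -/v -/g.
  have [i xE] : exists i, x = q i by exists ((q^-1)%g x); rewrite permKV.
  have [j yE] : exists j, y = q j by exists ((q^-1)%g y); rewrite permKV.
  move: xy; rewrite xE yE glueE -q3 !inE negb_or !(inj_eq perm_inj) => ij.
  move=> /andP[i3 j3] ije; have ije' := ije; rewrite setUC in ije'.
  move: ij i3 j3 ije ije' {xE yE}.
  case: (I4P i) (I4P j) => -> [] -> // _ _ _ ije ije';
    by [apply: H01 | apply: H02 | apply: H12
       | rewrite setUC [X in _ (+) (X == _)]setUC;
         by [apply: H01 | apply: H02 | apply: H12]].
have lower02 : ([set q v0; q v2] == [set q v0; q v1]) = false by rewrite set2_neq ?q_neq.
have lower12 : ([set q v1; q v2] == [set q v0; q v1]) = false by rewrite set2_neq ?q_neq.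
have upper0 i : i != v0 -> ([set q' i; q' v0] == [set q' v2; q' v3]) = false.
  by move=> ?; rewrite set2_neq ?q'_neq.
have [[r0 r1 r2]|[r0 r1 r2]|[r0 r1 r2]] := odd_perm4_v3_v1 r_odd r3.
- (* Both large edges are blue. *)
  exists true; apply: face_edges => e et; have := crossE _ _ _ et isT isT;
    rewrite ?r0 ?r1 ?r2 ?lower02 ?lower12 ?eqxx => eu.
  + by rewrite setUC upper0 // (above_col e).2.
  + by rewrite setUC upper0 // (below_col e).1.
  + by rewrite setUC eqxx (below_col e).2.
- (* A red edge of the tetrahedron below would be glued to a blue one of the
     tetrahedron above. *)
  have S2 : #|[set q v0; q v2]| = 2%N by rewrite cards2 q_neq.
  have [e et] := exists_edge t S2.
  have := crossE _ _ _ et isT isT; rewrite r0 r2 setUC => eu.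
  by have := (below_col e).1 et; rewrite (above_col e).2.
- (* Both large edges are red. *)
  exists false; apply: face_edges => e et; have := crossE _ _ _ et isT isT;
    rewrite ?r0 ?r1 ?r2 ?lower02 ?lower12 ?eqxx => eu.
  + by rewrite upper0 // (above_col e).1 // setUC.
  + by rewrite (below_col e).1.
  + by rewrite setUC upper0 // (below_col e).2.
Qed.

Lemma taut_mx_sign_conj (D : fundamental_domain a) :
  exists (r : 'I_#|face a| -> bool) (s : 'I_#|edge M| -> bool),
    forall i j, DU D i j = (-1) ^+ r i * DL D i j * (-1) ^+ s j.
Proof.
have [b bP] := choice large_edges_colour.
exists (fun i => b (enum_val i)), (fun j => is_red (enum_val j)) => i j.
rewrite /DU /DL /taut_mx [LHS]mxE [X in _ * X * _]mxE.
apply: signed_sum => S /and3P[/eqP S2 vS Se]; exact: bP S2 vS Se.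
Qed.

End Taut.

Theorem proposition5p2 (M : ideal_triangulation) (a : transverse_taut M)
    (V : veering a) (D : fundamental_domain a) :
  (exists phi : {linear lower_taut_module D -> upper_taut_module D}, bijective phi) /\
  (forall ThetaL ThetaU : groupring (H a),
     is_lower_taut_poly D ThetaL -> is_upper_taut_poly D ThetaU ->
     associated ThetaL ThetaU).
Proof.
have [r [s DUE]] := taut_mx_sign_conj V D.
split=> [|ThetaL ThetaU]; first exact: sign_conj_coker_iso DUE.
apply: gcd_associated.
- by move=> x y; apply: groupring_integral; apply: quot_torsion_free.
- by move=> x; apply: (sign_conj_minor DUE).
- by move=> x; apply: (sign_conj_minor (sign_conj_sym DUE)).
Qed.
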